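(* Let $1\leq p<\infty$. If $X$ is a Banach space, $G$ is a compact Hausdorff topological group, $F$ is a closed translation invariant (linear) subspace of $C(G)$, and $u\colon F\longrightarrow X$ is a translation invariant $p$-summing linear operator, then the normalized Haar measure $\sigma_G$ on $G$ is a Pietsch measure for $u$ in the sense that $$\|u(f)\|\leq \pi_p(u)\cdot\left(\int_G |f(x)|^p\,d\sigma_G(x)\right)^{\frac1p}\quad\text{for every } f\in F.$$
   Context: $C(G)$ is the Banach space of continuous functions $G\to\mathbb{K}$ ($\mathbb{K}=\mathbb{R}$ or $\mathbb{C}$) with the sup norm; the group $G$ is written multiplicatively and is not necessarily abelian. For $T\in C(G)$ and $\phi\in G$, $T^{\phi}\in C(G)$ is defined by $T^{\phi}(\varphi)=T(\phi\varphi)$. A nonempty set $F\subset C(G)$ is called closed (left) translation invariant if $\{T^{\phi}: T\in F,\ \phi\in G\}\subset F$. A map $u$ defined on such an $F$ is translation invariant if $u(T)=u(T^{\phi})$ for all $T\in F$ and $\phi\in G$. A continuous linear operator $u\colon F\to X$ is (absolutely) $p$-summing if there is a constant $C\geq 0$ such that $$\Big(\sum_{j=1}^m\|u(f_j)\|^p\Big)^{1/p}\leq C\cdot\sup_{\alpha\in B_{F^*}}\Big(\sum_{j=1}^m|\alpha(f_j)|^p\Big)^{1/p}$$ for all $m\in\mathbb{N}$ and $f_1,\ldots,f_m\in F$, where $B_{F^*}$ is the closed unit ball of the dual of $F$; the $p$-summing norm $\pi_p(u)$ is the infimum of such constants $C$. The normalized Haar measure $\sigma_G$ is the unique translation invariant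 Radon probability measure on the Borel sets of $G$, i.e. $\sigma_G(gB)=\sigma_G(B)$ for every Borel set $B$ and every $g\in G$. *)

(* Defs.v *)
From HB Require Import structures.
From mathcomp Require Import all_boot all_order all_algebra.
From mathcomp Require Import complex.
From mathcomp Require Import all_classical all_reals all_analysis.

Set Implicit Arguments.
Unset Strict Implicit.
Unset Printing Implicit Defensive.

Import Order.TTheory GRing.Theory Num.Theory.
Import numFieldNormedType.Exports.

Local Open Scope classical_set_scope.
Local Open Scope ring_scope.

Variant scalar_kind := RealScalars | ComplexScalars.

Definition scalar_field (R : realType) (k : scalar_kind) : numFieldType :=
  match k with RealScalars => R | ComplexScalars => R[i] end.

Definition real_to_scalar (R : realType) (k : scalar_kind) :
    R -> scalar_field R k :=
  match k with
  | RealScalars => fun x => x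
  | ComplexScalars => fun x => x%:C%C
  end.

Definition scalar_re (R : realType) (k : scalar_kind) :
    scalar_field R k -> R :=
  match k with
  | RealScalars => fun x => x
  | ComplexScalars => fun z => complex.Re z
  end.

(* In the library, norms over a numFieldType K take their values in K; over
   K = R[i] these values have zero imaginary part.  [rnorm] is the same norm,
   read in R. *)
Definition rnorm (R : realType) (k : scalar_kind)
    (V : normedZmodType (scalar_field R k)) (x : V) : R :=
  scalar_re `|x|.

Section scalar_theory.
Variables (R : realType) (k : scalar_kind).
Implicit Types (a b : R) (z : scalar_field R k).

Lemma real_to_scalarK : cancel (@real_to_scalar R k) (@scalar_re R k).
Proof. by case: k. Qed.

Lemma real_to_scalarD a b :
  real_to_scalar k (a + b) = real_to_scalar k a + real_to_scalar k b.
Proof. by case: k => //=; rewrite rmorphD. Qed.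

Lemma real_to_scalarM a b :
  real_to_scalar k (a * b) = real_to_scalar k a * real_to_scalar k b.
Proof. by case: k => //=; rewrite rmorphM. Qed.

Lemma le_real_to_scalar a b :
  (real_to_scalar k a <= real_to_scalar k b) = (a <= b).
Proof. by case: k => //=; rewrite lecR. Qed.

Lemma lt_real_to_scalar a b :
  (real_to_scalar k a < real_to_scalar k b) = (a < b).
Proof. by case: k => //=; rewrite ltcR. Qed.

Lemma norm_real_to_scalar (V : normedZmodType (scalar_field R k)) (x : V) :
  `|x| = real_to_scalar k (rnorm x).
Proof.
rewrite /rnorm; have := normr_ge0 x; case: k V x => //= V x.
by case: `|x| => u v; rewrite lecE /= => /andP[/eqP -> _].
Qed.

Section rnorm_theory.
Variable V : normedZmodType (scalar_field R k).
Implicit Types x y : V.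

Lemma rnorm_ge0 x : 0 <= rnorm x.
Proof.
have := normr_ge0 x; rewrite norm_real_to_scalar -(le_real_to_scalar 0).
by case: k V x.
Qed.

Lemma rnorm0_eq0 x : rnorm x = 0 -> x = 0.
Proof.
move=> x0; apply: normr0_eq0; rewrite norm_real_to_scalar x0.
by case: k.
Qed.

Lemma ler_rnormD x y : rnorm (x + y) <= rnorm x + rnorm y.
Proof.
rewrite -le_real_to_scalar real_to_scalarD -!norm_real_to_scalar.
exact: ler_normD.
Qed.

Lemma ler_dist_rnorm x y : `|rnorm x - rnorm y| <= rnorm (x - y).
Proof.
have H (u v : V) : rnorm u - rnorm v <= rnorm (u - v).
  by rewrite lerBlDr; apply: (le_trans _ (ler_rnormD (u - v) v)); rewrite subrK.
rewrite ler_norml H andbT lerNl opprB; apply: (le_trans (H y x)).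
by rewrite /rnorm distrC.
Qed.

End rnorm_theory.

Lemma rnormZ (V : normedModType (scalar_field R k)) (z : scalar_field R k)
    (x : V) :
  rnorm (z *: x) = rnorm z * rnorm x.
Proof.
apply: (can_inj real_to_scalarK).
by rewrite real_to_scalarM -!norm_real_to_scalar normrZ.
Qed.

Lemma rnorm_continuous (V : normedModType (scalar_field R k)) :
  continuous (fun x : V => rnorm x).
Proof.
move=> x; apply/cvgrPdist_lt => e e0.
have e0' : 0 < real_to_scalar k e.
  rewrite (_ : 0 = real_to_scalar k 0) ?lt_real_to_scalar//.
  by case: (k).
near=> y; apply: (le_lt_trans (ler_dist_rnorm x y)).
rewrite -lt_real_to_scalar -norm_real_to_scalar; near: y.
exact: (@cvgr_dist_lt _ _ _ _ _ id x cvg_id).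
Unshelve. all: by end_near. Qed.

End scalar_theory.

HB.mixin Record isTopologicalGroup G & Topological G & Group G := {
  mulg_continuous : continuous (fun xy : G * G => (xy.1 * xy.2)%g);
  invg_continuous : continuous (fun x : G => x^-1%g)
}.

#[short(type="topologicalGroupType")]
HB.structure Definition TopologicalGroup :=
  {G of Topological G & Group G & isTopologicalGroup G}.

HB.mixin Record isCompactHausdorff T & Topological T := {
  compact_setT : compact [set: T];
  hausdorff_setT : hausdorff_space T
}.

#[short(type="compactHausdorffGroupType")]
HB.structure Definition CompactHausdorffGroup :=
  {G of TopologicalGroup G & isCompactHausdorff G}.


(* C(G); the norm below is the sup norm, injected into the scalar field. *)
Definition cfun (R : realType) (k : scalar_kind)
    (G : compactHausdorffGroupType) : Type :=
  continuousType G (scalar_field R k)^o.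

HB.instance Definition _ (R : realType) (k : scalar_kind)
    (G : compactHausdorffGroupType) :=
  Choice.copy (cfun R k G) (continuousType G (scalar_field R k)^o).

Section cfun_normedModType.
Variables (R : realType) (k : scalar_kind) (G : compactHausdorffGroupType).
Implicit Types (f g h : cfun R k G) (a b : scalar_field R k).

Lemma cfunP f g : (forall x, f x = g x) -> f = g.
Proof. by move=> fg; apply/continuousEP. Qed.

Lemma cfun_cst_subproof a : continuous (fun _ : G => a : (scalar_field R k)^o).
Proof. by move=> x; exact: cvg_cst. Qed.

Lemma cfun_add_subproof f g :
  continuous (fun x : G => f x + g x : (scalar_field R k)^o).
Proof. by move=> x; apply: cvgD; exact: cts_fun. Qed.

Lemma cfun_opp_subproof f :
  continuous (fun x : G => - f x : (scalar_field R k)^o).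
Proof. by move=> x; apply: cvgN; exact: cts_fun. Qed.

Lemma cfun_scale_subproof a f :
  continuous (fun x : G => a *: f x : (scalar_field R k)^o).
Proof. by move=> x; apply: cvgZl_tmp; exact: cts_fun. Qed.

Definition cfun_zero : cfun R k G := mkcts (@cfun_cst_subproof 0).
Definition cfun_add f g : cfun R k G := mkcts (@cfun_add_subproof f g).
Definition cfun_opp f : cfun R k G := mkcts (@cfun_opp_subproof f).
Definition cfun_scale a f : cfun R k G := mkcts (@cfun_scale_subproof a f).

Lemma cfun_addA : associative cfun_add.
Proof. by move=> f g h; apply: cfunP => x; exact: addrA. Qed.
Lemma cfun_addC : commutative cfun_add.
Proof. by move=> f g; apply: cfunP => x; exact: addrC. Qed.
Lemma cfun_add0 : left_id cfun_zero cfun_add.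
Proof. by move=> f; apply: cfunP => x; exact: add0r. Qed.
Lemma cfun_addN : left_inverse cfun_zero cfun_opp cfun_add.
Proof. by move=> f; apply: cfunP => x; exact: addNr. Qed.

HB.instance Definition _ := GRing.isZmodule.Build (cfun R k G)
  cfun_addA cfun_addC cfun_add0 cfun_addN.

Lemma cfun_scaleA a b f : cfun_scale a (cfun_scale b f) = cfun_scale (a * b) f.
Proof. by apply: cfunP => x; exact: scalerA. Qed.
Lemma cfun_scale1 : left_id 1 cfun_scale.
Proof. by move=> f; apply: cfunP => x; exact: scale1r. Qed.
Lemma cfun_scaleDr : right_distributive cfun_scale +%R.
Proof. by move=> a f g; apply: cfunP => x; exact: scalerDr. Qed.
Lemma cfun_scaleDl f : {morph cfun_scale^~ f : a b / a + b}.
Proof. by move=> a b; apply: cfunP => x; exact: scalerDl. Qed.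

HB.instance Definition _ := GRing.Zmodule_isLmodule.Build (scalar_field R k)
  (cfun R k G) cfun_scaleA cfun_scale1 cfun_scaleDr cfun_scaleDl.

Definition supnorm f : R := sup (range (fun x => rnorm (f x))).

Lemma has_sup_cfun f : has_sup (range (fun x => rnorm (f x))).
Proof.
split; first by exists (rnorm (f 1%g)), 1%g.
have [| | |c _ fc] := @compact_EVT_max G R (fun x => rnorm (f x)) [set: G].
- by exists 1%g.
- exact: compact_setT.
- apply: continuous_subspaceT => x.
  by apply: continuous_comp; [exact: cts_fun|exact: rnorm_continuous].
- by exists (rnorm (f c)) => _ [x _ <-]; apply: fc; rewrite inE.
Qed.

Lemma le_supnorm f x : rnorm (f x) <= supnorm f.
Proof. by apply: ub_le_sup; [case: (has_sup_cfun f)|exists x]. Qed.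

Lemma supnorm_le f (c : R) : (forall x, rnorm (f x) <= c) -> supnorm f <= c.
Proof.
by move=> fc; apply: ge_sup => [|_ [x _ <-]//]; case: (has_sup_cfun f).
Qed.

Lemma ler_supnormD f g : supnorm (f + g) <= supnorm f + supnorm g.
Proof.
apply: supnorm_le => x; apply: (le_trans (ler_rnormD (f x) (g x))).
by apply: lerD; exact: le_supnorm.
Qed.

Lemma supnormZ a f : supnorm (a *: f) = rnorm a * supnorm f.
Proof.
have le b h : supnorm (b *: h) <= rnorm b * supnorm h.
  apply: supnorm_le => x; rewrite (rnormZ b (h x : (scalar_field R k)^o)).
  by rewrite ler_wpM2l ?rnorm_ge0// le_supnorm.
apply/eqP; rewrite eq_le le/=; have [->|a0] := eqVneq a 0.
  rewrite scale0r (_ : rnorm 0 = 0) ?mul0r.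
    exact: le_trans (rnorm_ge0 _) (le_supnorm _ 1%g).
  by apply: (can_inj (@real_to_scalarK R k)); rewrite -norm_real_to_scalar
    normr0; case: (k).
have ra : 0 < rnorm a.
  rewrite lt_neqAle rnorm_ge0 andbT eq_sym.
  by apply: contraNneq a0 => /rnorm0_eq0 ->.
rewrite -ler_pdivlMl// -[X in supnorm X <= _](scalerK a0).
apply: (le_trans (le _ _)); rewrite le_eqVlt; apply/orP; left; apply/eqP.
congr (_ * _); apply: (mulfI (lt0r_neq0 ra)); rewrite mulfV ?lt0r_neq0//.
rewrite -(rnormZ a (a^-1 : (scalar_field R k)^o)) /GRing.scale/= mulfV//.
by apply: (can_inj (@real_to_scalarK R k)); rewrite -norm_real_to_scalar
  normr1; case: (k).
Qed.

Lemma supnorm0_eq0 f : supnorm f = 0 -> f = 0.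
Proof.
move=> f0; apply: cfunP => x; apply: (@rnorm0_eq0 R k (scalar_field R k)).
by apply/eqP; rewrite eq_le rnorm_ge0 andbT -f0 le_supnorm.
Qed.

Let norm f : scalar_field R k := real_to_scalar k (supnorm f).

Let ler_normD f g : norm (f + g) <= norm f + norm g.
Proof. by rewrite /norm -real_to_scalarD le_real_to_scalar ler_supnormD. Qed.

Let normrZ a f : norm (a *: f) = `|a| * norm f.
Proof. by rewrite /norm supnormZ real_to_scalarM -norm_real_to_scalar. Qed.

Let normr0_eq0 f : norm f = 0 -> f = 0.
Proof.
move=> /(congr1 (@scalar_re R k)); rewrite real_to_scalarK => f0.
by apply: supnorm0_eq0; rewrite f0; case: (k).
Qed.

HB.instance Definition _ := Lmodule_isNormed.Build (scalar_field R k)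
  (cfun R k G) ler_normD normrZ normr0_eq0.

Lemma rnorm_cfunE f : rnorm f = supnorm f.
Proof. exact: real_to_scalarK. Qed.

End cfun_normedModType.

Section translation.
Variables (R : realType) (k : scalar_kind) (G : compactHausdorffGroupType).

Lemma translate_subproof (f : cfun R k G) (phi : G) :
  continuous (fun x : G => f (phi * x)%g).
Proof.
move=> x; apply: (@continuous_comp _ _ _ (fun x : G => (phi * x)%g) f).
  apply: (@continuous_comp _ _ _ (fun x : G => (phi, x))
    (fun xy : G * G => (xy.1 * xy.2)%g)); last exact: mulg_continuous.
  by apply: cvg_pair; [exact: cvg_cst|exact: cvg_id].
exact: cts_fun.
Qed.

Definition translate (f : cfun R k G) (phi : G) : cfun R k G :=
  mkcts (@translate_subproof f phi).

(* "closed" here means stable under left translations, not topologically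
   closed. *)
Definition closed_translation_invariant (F : set (cfun R k G)) :=
  F !=set0 /\ forall f phi, F f -> F (translate f phi).

Definition translation_invariant_on (X : Type) (F : set (cfun R k G))
    (u : cfun R k G -> X) :=
  forall f phi, F f -> u f = u (translate f phi).

End translation.

Section summing.
Variables (R : realType) (k : scalar_kind).

Definition linear_subspace (V : lmodType (scalar_field R k)) (F : set V) :=
  F 0 /\ forall (a : scalar_field R k) f g, F f -> F g -> F (a *: f + g).

(* An operator defined on a subspace F of V is encoded by a total map on V of
   which only the restriction to F is ever used; likewise for functionals. *)
Definition linear_on (V W : lmodType (scalar_field R k)) (F : set V)
    (u : V -> W) :=
  forall (a : scalar_field R k) f g,
    F f -> F g -> u (a *: f + g) = a *: u f + u g.

Variables (E X : normedModType (scalar_field R k)).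

(* A linear functional bounded by the norm on F is continuous on F with
   operator norm at most 1, and conversely. *)
Definition dual_ball (F : set E) : set (E -> (scalar_field R k)^o) :=
  [set alpha | linear_on F alpha /\
    forall f, F f -> rnorm (alpha f) <= rnorm f].

Definition summing_constant (F : set E) (p : R) (u : E -> X) (C : R) :=
  0 <= C /\
  forall (m : nat) (f : 'I_m -> E), (forall j, F (f j)) ->
    (\sum_(j < m) rnorm (u (f j)) `^ p) `^ p^-1 <=
    C * sup [set (\sum_(j < m) rnorm (alpha (f j)) `^ p) `^ p^-1
            | alpha in dual_ball F].

Definition p_summing (F : set E) (p : R) (u : E -> X) :=
  [/\ linear_on F u, {within F, continuous u}
    & exists C, summing_constant F p u C].

Definition summing_norm (F : set E) (p : R) (u : E -> X) : R :=
  inf [set C | summing_constant F p u C].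

End summing.

(* Measurable types are pointed in the library; the point plays no role. *)
Definition pointed_group (G : topologicalGroupType) : Type := G.
HB.instance Definition _ (G : topologicalGroupType) :=
  Choice.copy (pointed_group G) G.
HB.instance Definition _ (G : topologicalGroupType) :=
  isPointed.Build (pointed_group G) 1%g.

Definition borel (G : topologicalGroupType) :=
  g_sigma_algebraType (@open G : set (set (pointed_group G))).

(* The measure is finite, so local finiteness is automatic; compact sets are
   Borel whenever G is Hausdorff. *)
Definition radon (R : realType) (G : topologicalGroupType)
    (mu : probability (borel G) R) :=
  forall B : set (borel G), measurable B ->
    mu B =
    ereal_sup [set mu K | K in [set K | compact (K : set G) /\ K `<=` B]].

Definition normalized_haar (R : realType) (G : topologicalGroupType)
    (sigma : probability (borel G) R) :=
  radon sigma /\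
  forall (g : G) (B : set (borel G)), measurable B ->
    sigma [set (g * x)%g | x in (B : set G)] = sigma B.

(* Main.v *)
(* No Pietsch measure is constructed.  Averaging over the group yields weights
   [w_j] and translations [psi_j] with
   [\sum_j w_j |f (psi_j x)|^p <= \int |f|^p + e] for all [x] at once.  Apply
   the summing inequality to the functions [w_j^(1/p) f^(psi_j)]: by
   translation invariance of [u] the left-hand side is [|u f|], and the weak
   p-norm on the right is at most the supremum over [x] of
   [(\sum_j w_j |f (psi_j x)|^p)^(1/p)]. *)

Require Import Defs.
From mathcomp Require Import all_boot all_order all_algebra.
From mathcomp Require Import all_classical all_reals all_analysis.
From mathcomp Require Import measurable_realfun lra.

Set Implicit Arguments.
Unset Strict Implicit.
Unset Printing Implicit Defensive.

Import Order.TTheory GRing.Theory Num.Theory.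
Import numFieldNormedType.Exports.

Local Open Scope classical_set_scope.
Local Open Scope ring_scope.

(** * Young's inequality and continuity of real powers *)

(** Young's inequality for the conjugate exponents [p / (p - 1)] and [p], cleared of denominators so
    that [p = 1] is included; in that case the power with exponent [0] is [1] even at [a = 0]. *)
Lemma young_powR (R : realType) (a b p : R) : 0 <= a -> 0 <= b -> 1 <= p ->
  p * (a `^ (p - 1) * b) <= (p - 1) * a `^ p + b `^ p.
Proof.
move=> a0 b0; rewrite le_eqVlt => /predU1P[<-|p1].
  by rewrite subrr powRr0 !mul1r mul0r add0r powRr1.
have p0 : 0 < p by apply: lt_trans p1.
have q0 : 0 < p - 1 by rewrite subr_gt0.
have := @conjugate_powR R (a `^ (p - 1)) b (p / (p - 1)) p
  (powR_ge0 _ _) b0 (divr_gt0 p0 q0) p0.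
rewrite -powRrM mulrCA divff ?gt_eqF// mulr1 invf_div.
rewrite -[X in _ + X = 1]div1r -mulrDl subrK divff ?gt_eqF// => /(_ erefl).
rewrite -(ler_pM2l p0) => /le_trans; apply.
rewrite mulrDr le_eqVlt; apply/orP; left; apply/eqP; congr (_ + _).
  by rewrite mulrCA (mulrC p) divfK ?gt_eqF// mulrC.
by rewrite mulrC divfK ?gt_eqF.
Qed.

Lemma continuous_powR_nneg (R : realType) (T : topologicalType) (h : T -> R)
    (p : R) :
  0 < p -> (forall x, 0 <= h x) -> continuous h ->
  continuous (fun x => h x `^ p).
Proof.
move=> p0 h0 ch x; have := h0 x; rewrite le_eqVlt => /predU1P[hx0|hx0].
  apply/cvgrPdist_lt => e e0; rewrite -hx0 powR0 ?gt_eqF//.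
  (* The radius whose [p]-th power is [e]. Zeros of [h] are treated by hand, since the derivative of
     the power used below requires [0 < h x]. *)
  have d0 : 0 < e `^ p^-1 by rewrite powR_gt0.
  near=> y; rewrite sub0r normrN ger0_norm ?powR_ge0//.
  rewrite -[ltRHS](powRr1 (ltW e0)) -(mulVf (lt0r_neq0 p0)) powRrM.
  rewrite gt0_ltr_powR// ?nnegrE ?powR_ge0//.
  rewrite -[ltLHS]ger0_norm// -[h y]subr0 hx0 distrC.
  near: y; exact: (@cvgr_dist_lt _ _ _ _ _ _ _ (ch x)).
apply: (@continuous_comp _ _ _ h (fun t => t `^ p)); first exact: ch.
apply: differentiable_continuous; apply/derivable1_diffP.
by have [] := is_derive1_powR p hx0.
Unshelve. all: by end_near. Qed.

(** * Scalars, and linear maps on a subspace *)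

Section scalars.
Variables (R : realType) (k : scalar_kind).

Lemma rnorm_real_to_scalar (a : R) : 0 <= a -> rnorm (real_to_scalar k a) = a.
Proof.
move=> a0; rewrite /rnorm ger0_norm ?real_to_scalarK//.
rewrite (_ : 0 = real_to_scalar k 0) ?le_real_to_scalar//.
by case: k.
Qed.

Lemma rnormM (a b : scalar_field R k) : rnorm (a * b) = rnorm a * rnorm b.
Proof. exact: (@rnormZ R k (scalar_field R k)^o). Qed.

Lemma rnorm0 (V : normedZmodType (scalar_field R k)) : rnorm (0 : V) = 0.
Proof. by rewrite /rnorm normr0; case: k V. Qed.

Lemma rnorm_sum_le (V : normedZmodType (scalar_field R k)) (n : nat)
    (v : 'I_n -> V) : rnorm (\sum_i v i) <= \sum_i rnorm (v i).
Proof.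
apply: (big_ind2 (fun x y => rnorm x <= y)) => // [|x a y b xa yb].
  by rewrite rnorm0.
exact: le_trans (ler_rnormD x y) (lerD xa yb).
Qed.

Lemma real_to_scalar_sum (n : nat) (a : 'I_n -> R) :
  real_to_scalar k (\sum_i a i) = \sum_i real_to_scalar k (a i).
Proof. by apply: (big_morph _ (real_to_scalarD k)); case: k. Qed.

(** The bound on [rnorm c] cannot be an equality with the witness chosen: at [a = 0] the convention
    [0^-1 = 0] gives [c = 0]. *)
Lemma exists_phase (a : scalar_field R k) :
  exists2 c : scalar_field R k,
    rnorm c <= 1 & c * a = real_to_scalar k (rnorm a).
Proof.
rewrite -norm_real_to_scalar; exists (`|a| / a).
  have [->|a0] := eqVneq a 0.
    by rewrite invr0 mulr0 rnorm0.
  rewrite /rnorm normrM normfV normr_id divff ?normr_eq0//.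
  by case: k a a0.
have [->|a0] := eqVneq a 0; first by rewrite mulr0 normr0.
by rewrite divfK.
Qed.

Lemma linear_on0 (V W : lmodType (scalar_field R k)) (F : set V) (u : V -> W) :
  linear_subspace F -> linear_on F u -> u 0 = 0.
Proof.
move=> [F0 _] ul; have := ul (-1) 0 0 F0 F0.
by rewrite scaler0 addr0 scaleN1r addNr.
Qed.

Lemma linear_onZ (V W : lmodType (scalar_field R k)) (F : set V) (u : V -> W)
    (c : scalar_field R k) (f : V) :
  linear_subspace F -> linear_on F u -> F f -> u (c *: f) = c *: u f.
Proof.
move=> Fl ul Ff; have := ul c f 0 Ff (proj1 Fl).
by rewrite !addr0 (linear_on0 Fl ul) addr0.
Qed.

Lemma linear_subspaceZ (V : lmodType (scalar_field R k)) (F : set V)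
    (c : scalar_field R k) (f : V) :
  linear_subspace F -> F f -> F (c *: f).
Proof. by move=> [F0 Fl] Ff; rewrite -[_ *: _]addr0; exact: Fl. Qed.

(** One induction serves both conclusions: [u] is linear on [F] only, so each step needs the partial
    sum to lie in [F]. *)
Lemma linear_on_sum (V W : lmodType (scalar_field R k)) (F : set V) (u : V -> W)
    (n : nat) (c : 'I_n -> scalar_field R k) (f : 'I_n -> V) :
  linear_subspace F -> linear_on F u -> (forall i, F (f i)) ->
  F (\sum_i c i *: f i) /\ u (\sum_i c i *: f i) = \sum_i c i *: u (f i).
Proof.
move=> Fl ul Ff.
apply: (big_rec2 (fun v w => F v /\ u v = w)) => [|i v w _ [Fv <-]].
  by split; [exact: (proj1 Fl)|exact: linear_on0 ul].
by split; [apply: (proj2 Fl)|apply: ul].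
Qed.

End scalars.

(** * Weak [p]-sums over the dual ball of a subspace of [C(G)] *)

Lemma cfun_sumE (R : realType) (k : scalar_kind) (G : compactHausdorffGroupType)
    (n : nat) (f : 'I_n -> cfun R k G) (x : G) :
  (\sum_i f i) x = \sum_i f i x.
Proof. exact: (big_morph (fun h : cfun R k G => h x)). Qed.

(* Write [a_i := alpha (f i)].  Testing [alpha] on [\sum_i c_i f_i], where
   [c_i a_i = |a_i|^p] and [|c_i| <= |a_i|^(p-1)], turns the bound on [alpha]
   into a pointwise estimate, so that no representation of the dual of [F] by
   measures is needed. *)
Lemma dual_ball_sum_powR (R : realType) (k : scalar_kind)
    (G : compactHausdorffGroupType) (F : set (cfun R k G))
    (alpha : cfun R k G -> (scalar_field R k)^o) (p M : R) (n : nat)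
    (f : 'I_n -> cfun R k G) :
  1 <= p -> linear_subspace F -> dual_ball F alpha -> (forall i, F (f i)) ->
  (forall x, \sum_i rnorm (f i x) `^ p <= M) ->
  \sum_i rnorm (alpha (f i)) `^ p <= M.
Proof.
move=> p1 Flin [alin ale] Ff fM; have p0 : 0 < p by apply: lt_le_trans p1.
have /choice[c /all_and2[c1 ca]] i : exists c : scalar_field R k,
    rnorm c <= 1 /\ c * alpha (f i) = real_to_scalar k (rnorm (alpha (f i))).
  by have [c c1 ca] := exists_phase (alpha (f i)); exists c.
pose d i := real_to_scalar k (rnorm (alpha (f i)) `^ (p - 1)) * c i.
have [Fs sE] := linear_on_sum d Flin alin Ff.
set A := \sum_i _.
have A0 : 0 <= A by apply: sumr_ge0 => i _; exact: powR_ge0.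
have alphaE : rnorm (alpha (\sum_i d i *: f i)) = A.
  rewrite sE -[RHS](rnorm_real_to_scalar k A0) real_to_scalar_sum.
  congr rnorm; apply: eq_bigr => i _.
  rewrite /d /GRing.scale/= -mulrA ca -real_to_scalarM mulrC.
  by rewrite mulr_powRB1 ?rnorm_ge0.
(* Young's inequality at each point, in place of Hölder's: subtracting [(p - 1) * A] leaves
   [A <= M], with no division by a power of [A], so [A = 0] is no special case. *)
have : p * A <= (p - 1) * A + M.
  rewrite mulrC -ler_pdivlMr// -alphaE (le_trans (ale _ Fs))// rnorm_cfunE.
  apply: supnorm_le => x; rewrite ler_pdivlMr// mulrC cfun_sumE.
  apply: (@le_trans _ _
    (p * \sum_i rnorm (alpha (f i)) `^ (p - 1) * rnorm (f i x))).
    rewrite ler_pM2l//; apply: (le_trans (rnorm_sum_le _)).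
    apply: ler_sum => i _.
    rewrite (rnormZ (d i) (f i x : (scalar_field R k)^o)).
    rewrite ler_wpM2r ?rnorm_ge0// rnormM rnorm_real_to_scalar ?powR_ge0//.
    by rewrite ler_piMr ?powR_ge0.
  apply: (@le_trans _ _ ((p - 1) * A + \sum_i rnorm (f i x) `^ p)).
    rewrite !mulr_sumr -big_split/=; apply: ler_sum => i _.
    by apply: young_powR; rewrite ?rnorm_ge0.
  by rewrite alphaE lerD2l.
by rewrite mulrBl mul1r -lerBlDl opprB addrCA subrr addr0.
Qed.

(** * Borel measurability of continuous functions and translations *)

Lemma continuous_lmulg (G : topologicalGroupType) (g : G) :
  continuous (fun x : G => (g * x)%g).
Proof.
move=> x; apply: (@continuous_comp _ _ _ (fun x : G => (g, x))
    (fun xy : G * G => (xy.1 * xy.2)%g)); last exact: mulg_continuous.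
by apply: cvg_pair; [exact: cvg_cst|exact: cvg_id].
Qed.

Section borel_measurability.
Variables (R : realType) (G : topologicalGroupType).

Lemma open_measurable_borel (A : set G) :
  open A -> measurable (A : set (borel G)).
Proof. by move=> oA; exact: sub_sigma_algebra. Qed.

Lemma continuous_measurable_borel (g : G -> R) :
  continuous g -> measurable_fun [set: borel G] (g : borel G -> R).
Proof.
move=> /continuousP cg; apply: (measurability _ (RGenOpens.measurableE R)).
move=> _ [_ [a [b ->] <-]]; rewrite setTI; apply: open_measurable_borel.
by apply: cg; exact: interval_open.
Qed.

Lemma mulg_measurable_borel (a : G) :
  measurable_fun [set: borel G] ((fun x => (a * x)%g) : borel G -> borel G).
Proof.
apply: (@measurability _ _ (borel G) (borel G) setT _ open) => //.
move=> _ [A oA <-]; rewrite setTI; apply: open_measurable_borel.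
move: A oA; apply/continuousP; exact: continuous_lmulg.
Qed.

End borel_measurability.

(** * Integrals against a probability measure and step functions *)

Lemma sum_probability_partition d (T : measurableType d) (R : realType)
    (P : probability T R) (N : nat) (D : nat -> set T) :
  (forall i, measurable (D i)) -> trivIset setT D ->
  \big[setU/set0]_(i < N) D i = setT ->
  \sum_(i < N) fine (P (D i)) = 1.
Proof.
move=> mD tD DT; rewrite sum_fine; last by move=> i _; exact: fin_num_measure.
suff -> : (\sum_(i < N) P (D i) = 1)%E by [].
by rewrite -(probability_setT P) -DT; apply/esym/measure_bigsetU.
Qed.

(** The error on each cell is at most [e] times the mass of the cell, and the masses add up to
    [1]. *)
Lemma step_approx_Rintegral d (T : measurableType d) (R : realType)
    (P : probability T R) (N : nat) (D : nat -> set T) (h : T -> R)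
    (c : nat -> R) (e : R) :
  (forall i, measurable (D i)) -> trivIset setT D ->
  \big[setU/set0]_(i < N) D i = setT ->
  P.-integrable setT (EFin \o h) ->
  (forall i x, (i < N)%N -> D i x -> `|h x - c i| <= e) ->
  `|\int[P]_x h x - \sum_(i < N) fine (P (D i)) * c i| <= e.
Proof.
move=> mD tD DT ih hc.
have ihD i : P.-integrable (D i) (EFin \o h).
  by apply: (@integrableS _ _ _ P setT).
have icD i (r : R) : P.-integrable (D i) (EFin \o cst r).
  exact: finite_measure_integrable_cst.
have ihcD i (r : R) : P.-integrable (D i) (EFin \o (fun x => h x - r)).
  exact: (integrableB (mD i) (ihD i) (icD i r)).
have -> : \int[P]_x h x = \sum_(i < N) \int[P]_(x in D i) h x.
  rewrite /Rintegral -DT -(big_mkord xpredT D).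
  rewrite integral_bigsetU_EFin ?iota_uniq//; first last.
  - by rewrite big_mkord DT; case/integrableP: ih.
  - exact: sub_trivIset tD.
  by rewrite -sum_fine ?big_mkord// => i _; exact: integrable_fin_num.
have -> : e = \sum_(i < N) e * fine (P (D i)).
  by rewrite -mulr_sumr sum_probability_partition// mulr1.
rewrite -sumrB (le_trans (ler_norm_sum _ _ _))//; apply: ler_sum => i _.
rewrite mulrC -Rintegral_cst// -RintegralB//; last exact: icD.
apply: (le_trans (le_normr_Rintegral _ _)) => //.
rewrite -Rintegral_cst//; apply: le_Rintegral => //.
- exact: integrable_norm.
- exact: icD.
- by move=> x Dx; exact: hc.
Qed.

(** * The Haar integral and finite averages of translates *)

Section compact_group.
Variables (R : realType) (G : compactHausdorffGroupType).
Implicit Types (g : G -> R) (a t : G).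

Lemma continuous_integrable_borel (P : probability (borel G) R) g :
  continuous g -> P.-integrable setT (EFin \o (g : borel G -> R)).
Proof.
move=> cg; apply: measurable_bounded_integrable => //.
- exact: le_lt_trans (probability_le1 P measurableT) (ltry 1).
- exact: continuous_measurable_borel.
have [| | |c _ gc] := @compact_EVT_max G R (fun x => `|g x|) [set: G].
- by exists 1%g.
- exact: compact_setT.
- by apply: continuous_subspaceT => x; apply: cvg_norm; exact: cg.
exists `|g c|; split; first exact: num_real.
by move=> M /ltW cM x _; apply: le_trans (gc x _) cM; rewrite inE.
Qed.

Lemma haar_Rintegral_translate (sigma : probability (borel G) R) g a :
  normalized_haar sigma -> continuous g ->
  \int[sigma]_x g (a * x)%g = \int[sigma]_x g x.
Proof.
move=> [_ inv] cg; have ma := mulg_measurable_borel a.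
have cga : continuous (fun x => g (a * x)%g).
  by move=> x; apply: continuous_comp; [exact: continuous_lmulg|exact: cg].
rewrite /Rintegral; congr fine.
transitivity (\int[pushforward sigma (fun x : borel G => (a * x)%g : borel G)]_x
    (g x)%:E)%E.
  rewrite integral_pushforward//.
  - by apply/measurable_EFinP; exact: continuous_measurable_borel.
  - by rewrite preimage_setT; exact: (continuous_integrable_borel sigma cga).
apply: eq_measure_integral => A mA _; rewrite /pushforward.
(* Invariance is stated for images: the preimage of [A] under translation by [a] is its image under
   translation by [a^-1]. *)
rewrite -[RHS](inv a^-1%g)//; congr (sigma _).
apply/seteqP; split => [x Ax|_ [y Ay <-]]; last by rewrite /= mulVKg.
by exists (a * x)%g => //; rewrite mulKg.
Qed.

(** A tube argument: near each [(x, t)] both values are within [e / 2] of [g (t^-1 * x)], by joint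
    continuity, and compactness in [y] yields one neighbourhood of [t] valid for all [y]. *)
Lemma near_translate_le g t (e : R) : continuous g -> 0 < e ->
  \forall s \near t, forall y, `|g (s^-1 * y)%g - g (t^-1 * y)%g| <= e.
Proof.
move=> cg e0.
have cgV : continuous (fun ys : G * G => g (ys.2^-1 * ys.1)%g).
  move=> ys; apply: (@continuous_comp _ _ _
    (fun ys : G * G => (ys.2^-1 * ys.1)%g) g); last exact: cg.
  apply: (@continuous_comp _ _ _ (fun ys : G * G => (ys.2^-1%g, ys.1))
    (fun xy : G * G => (xy.1 * xy.2)%g)); last exact: mulg_continuous.
  apply: cvg_pair; last exact: cvg_fst.
  by apply: (@continuous_comp _ _ _ snd (fun x : G => x^-1%g));
    [exact: cvg_snd|exact: invg_continuous].
have e2 : 0 < e / 2 by rewrite divr_gt0.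
have /compact_near_coveringP cov := @compact_setT G.
have : \forall s \near t, [set: G] `<=`
    (fun y => `|g (s^-1 * y)%g - g (t^-1 * y)%g| <= e).
  apply: (cov _ _ (fun s y => `|g (s^-1 * y)%g - g (t^-1 * y)%g| <= e)).
  move=> x _.
  have xt : \forall ys \near (x, t),
      `|g (t^-1 * x)%g - g (ys.2^-1 * ys.1)%g| < e / 2.
    exact: (@cvgr_dist_lt _ _ _ _ _ _ _ (cgV (x, t))).
  have cgt : continuous (fun ys : G * G => g (t^-1 * ys.1)%g).
    move=> ys; apply: (@continuous_comp _ _ _ fst (fun y => g (t^-1 * y)%g)).
      exact: cvg_fst.
    by apply: continuous_comp; [exact: continuous_lmulg|exact: cg].
  have xx : \forall ys \near (x, t),
      `|g (t^-1 * x)%g - g (t^-1 * ys.1)%g| < e / 2.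
    exact: (@cvgr_dist_lt _ _ _ _ _ _ _ (cgt (x, t))).
  apply: filterS2 xt xx => -[y s] /= h1 h2.
  rewrite -[X in X - _](subrK (g (t^-1 * x)%g)) -addrA.
  rewrite (le_trans (ler_normD _ _))// [leRHS]splitr lerD// ltW//.
  by rewrite distrC.
by apply: filterS => s Hs y; exact: Hs.
Qed.

End compact_group.

(* Stated without [compact_cover], which requires a pointed space.  Finite
   subcovers come from near-covering compactness applied to the filter of
   "eventually under extension" on finite sequences of points. *)
Lemma compact_finite_cover (T : topologicalType) (U : T -> set T) :
  compact [set: T] -> (forall t, nbhs t (U t)) ->
  exists s : seq T, forall x, exists2 t, t \in s & U t x.
Proof.
move=> /compact_near_coveringP cov nU.
pose F := [set A : set (seq T) | exists t : seq T,
  forall s : seq T, {subset t <= s} -> A s].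
have FF : Filter F.
  split=> [|A B [t tA] [t' t'B]|A B AB [t tA]].
  - by exists [::].
  - exists (t ++ t') => s ts; split.
      by apply: tA => x xt; apply: ts; rewrite mem_cat xt.
    by apply: t'B => x xt; apply: ts; rewrite mem_cat xt orbT.
  - by exists t => s /tA /AB.
have [x _|s /(_ s) sU] := cov (seq T) F
  (fun (s : seq T) (x : T) => exists2 t, t \in s & U t x) FF.
  exists (U x, [set s : seq T | x \in s]) => /=; last first.
    by case=> y s /= [Uxy xs]; exists x.
  split; first exact: nU.
  by exists [:: x] => s; apply; rewrite mem_head.
by exists s => x; apply: sU.
Qed.

Lemma Rintegral_sum d (T : measurableType d) (R : realType)
    (P : {measure set T -> \bar R}) (n : nat) (f : 'I_n -> T -> R) :
  (forall i, P.-integrable setT (EFin \o f i)) ->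
  \int[P]_x (\sum_i f i x) = \sum_i \int[P]_x f i x.
Proof.
move=> fi; rewrite /Rintegral sum_fine; last first.
  by move=> i _; have := integrable_fin_num measurableT (fi i).
rewrite -integral_sum//; congr fine; apply: eq_integral => x _.
by rewrite sumEFin.
Qed.

(* A left-invariant [sigma] is not assumed right-invariant: averaging
   [g (t^-1 * x)] rather than [g (t * x)] over [t] makes left invariance alone
   give an average [c] independent of [x]; integrating in [x] then identifies
   [c] with the integral of [g]. *)
Lemma haar_finite_average (R : realType) (G : compactHausdorffGroupType)
    (sigma : probability (borel G) R) (g : G -> R) (e : R) :
  normalized_haar sigma -> continuous g -> 0 < e ->
  exists (n : nat) (w : 'I_n -> R) (psi : 'I_n -> G),
    [/\ forall i, 0 <= w i, \sum_i w i = 1 &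
      forall x, \sum_i w i * g (psi i * x)%g <= \int[sigma]_x g x + e].
Proof.
move=> haar cg e0; have e2 : 0 < e / 2 by rewrite divr_gt0.
pose V t := [set s | forall y, `|g (s^-1 * y)%g - g (t^-1 * y)%g| <= e / 2].
(* [V t] is only known to be a neighbourhood of [t]; its interior is open, hence Borel. *)
pose U t : set G := (V t)°.
have [s sU] := compact_finite_cover (@compact_setT G)
  (fun t => nbhs_interior (near_translate_le t cg e2)).
pose N := size s.
pose W i := U (nth 1%g s i).
(* Making the cover disjoint gives a Borel partition. Cell masses become the weights and inverses of
   the centres the translations, so the average is a step approximation of the integral of
   [g (t^-1 * x)] over [t]. *)
pose D := seqDU W.
have mU t : measurable (U t : set (borel G)).
  by apply: open_measurable_borel; exact: open_interior.
have mD i : measurable (D i : set (borel G)).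
  apply: measurableD; first exact: mU.
  by apply: (@bigsetU_measurable _ (borel G)) => k _; exact: mU.
have DT : \big[setU/set0]_(i < N) D i = setT.
  rewrite -bigsetU_seqDU -subTset => x _.
  have [t ts Utx] := sU x; rewrite -(bigcup_mkord _ W).
  by exists (index t s) => /=; rewrite ?index_mem// /W nth_index.
have tD : trivIset setT (D : nat -> set (borel G)) by exact: trivIset_seqDU.
pose w (i : 'I_N) := fine (sigma (D i)).
pose psi (i : 'I_N) := ((nth 1%g s i)^-1)%g.
have cgpsi a : continuous (fun x => g (a * x)%g).
  by move=> x; apply: continuous_comp; [exact: continuous_lmulg|exact: cg].
have cgV x : continuous (fun t => g (t^-1 * x)%g).
  move=> t; apply: (@continuous_comp _ _ _
    (fun t : G => (t^-1 * x)%g) g); last exact: cg.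
  apply: (@continuous_comp _ _ _ (fun t : G => (t^-1%g, x))
    (fun xy : G * G => (xy.1 * xy.2)%g)); last exact: mulg_continuous.
  by apply: cvg_pair; [exact: invg_continuous|exact: cvg_cst].
pose c := \int[sigma]_t g (t^-1)%g.
have cE x : \int[sigma]_t g (t^-1 * x)%g = c.
  (* Replacing [t] by [x * t] turns [t^-1 * x] into [t^-1]. *)
  rewrite -(haar_Rintegral_translate x haar (cgV x)).
  by apply: eq_Rintegral => t _; rewrite invgM mulgVK.
have approx x : `|c - \sum_i w i * g (psi i * x)%g| <= e / 2.
  rewrite -(cE x).
  apply: (step_approx_Rintegral (c := fun i => g ((nth 1%g s i)^-1 * x)%g)
    mD tD DT (continuous_integrable_borel sigma (cgV x))).
  move=> i t _ Dit.
  exact: (@interior_subset _ (V _) _ (subset_seqDU Dit)).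
have w0 i : 0 <= w i by exact: fine_ge0.
have w1 : \sum_i w i = 1 by exact: sum_probability_partition.
have iw i : sigma.-integrable setT
    (EFin \o (fun x : borel G => w i * g (psi i * x)%g)).
  apply: (continuous_integrable_borel sigma) => x.
  by apply: cvgM; [exact: cvg_cst|exact: cgpsi].
(* The lower bound from [approx] is integrated in [x]: all translates have the integral of [g], and
   only a finite sum is exchanged with the integral, so Fubini is avoided. The other [e / 2] is
   spent on the upper bound. *)
have cle : c - e / 2 <= \int[sigma]_x g x.
  have -> : \int[sigma]_x g x = \int[sigma]_x (\sum_i w i * g (psi i * x)%g).
    rewrite Rintegral_sum//.
    rewrite (eq_bigr (fun i => w i * \int[sigma]_x g x)) => [|i _].
      by rewrite -mulr_suml w1 mul1r.
    rewrite -(haar_Rintegral_translate (psi i) haar cg).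
    apply: RintegralZl => //.
    exact: (continuous_integrable_borel sigma (cgpsi (psi i))).
  have -> : c - e / 2 = \int[sigma]_(x in [set: borel G]) (c - e / 2).
    rewrite Rintegral_cst// -[LHS]mulr1; congr (_ * _).
    by have /(congr1 fine) := probability_setT sigma.
  apply: le_Rintegral => //.
  - exact: finite_measure_integrable_cst.
  - rewrite (_ : _ \o _ = fun x => \sum_i (w i * g (psi i * x)%g)%:E)%E.
      by apply: integrable_sum => // i _; exact: iw.
    by apply/funext => x /=; rewrite sumEFin.
  - by move=> x _; have := approx x; rewrite ler_distlC => /andP[]; lra.
exists N, w, psi; split => // x.
have := approx x; rewrite ler_distlC => /andP[_].
by move/le_trans; apply; rewrite [e in leRHS]splitr addrA lerD2r -lerBlDr.
Qed.

(** * The Pietsch inequality for the Haar measure *)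

Lemma rnormZ_powR (R : realType) (k : scalar_kind)
    (V : normedModType (scalar_field R k)) (w p : R) (v : V) :
  0 < p -> 0 <= w ->
  rnorm (real_to_scalar k (w `^ p^-1) *: v) `^ p = w * rnorm v `^ p.
Proof.
move=> p0 w0; rewrite rnormZ rnorm_real_to_scalar ?powR_ge0//.
rewrite powRM ?powR_ge0 ?rnorm_ge0// -powRrM mulVf ?gt_eqF//.
by rewrite powRr1.
Qed.

(** Stated for every admissible [C], so that the infimum defining [summing_norm] is taken only
    afterwards. *)
Lemma summing_constant_haar (R : realType) (k : scalar_kind)
    (G : compactHausdorffGroupType) (X : normedModType (scalar_field R k))
    (F : set (cfun R k G)) (u : cfun R k G -> X) (p C : R)
    (sigma : probability (borel G) R) (f : cfun R k G) :
  1 <= p -> linear_subspace F -> closed_translation_invariant F ->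
  linear_on F u -> translation_invariant_on F u -> normalized_haar sigma ->
  summing_constant F p u C -> F f ->
  rnorm (u f) <= C * (\int[sigma]_x (rnorm (f x) `^ p)) `^ p^-1.
Proof.
move=> p1 Flin [_ Ftr] ulin uinv haar [C0 hC] Ff.
have p0 : 0 < p by apply: lt_le_trans p1.
have pV0 : 0 < p^-1 by rewrite invr_gt0.
pose g (x : G) := rnorm (f x) `^ p.
have cg : continuous g.
  apply: continuous_powR_nneg => // [x|x]; first exact: rnorm_ge0.
  by apply: continuous_comp; [exact: cts_fun|exact: rnorm_continuous].
set J := Rintegral _ _ _.
have J0 : 0 <= J by apply: Rintegral_ge0 => x _; exact: powR_ge0.
have powRK (a : R) : 0 <= a -> (a `^ p) `^ p^-1 = a.
  by move=> a0; rewrite -powRrM mulfV ?gt_eqF// powRr1.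
have powRVK (a : R) : 0 <= a -> (a `^ p^-1) `^ p = a.
  by move=> a0; rewrite -powRrM mulVf ?gt_eqF// powRr1.
have approx e : 0 < e -> rnorm (u f) <= C * (J + e) `^ p^-1.
  move=> e0; have [n [w [psi [w0 w1 wle]]]] := haar_finite_average haar cg e0.
  pose h i := real_to_scalar k (w i `^ p^-1) *: translate f (psi i).
  have Fh i : F (h i) by apply: linear_subspaceZ => //; exact: Ftr.
  have := hC n h Fh.
  have -> : (\sum_j rnorm (u (h j)) `^ p) `^ p^-1 = rnorm (u f).
    rewrite (eq_bigr (fun j => w j * rnorm (u f) `^ p)) => [|j _].
      by rewrite -mulr_suml w1 mul1r powRK ?rnorm_ge0.
    by rewrite (linear_onZ _ Flin ulin (Ftr _ _ Ff)) -uinv// rnormZ_powR.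
  move=> /le_trans; apply; rewrite ler_wpM2l//; apply: ge_sup.
    (* The zero functional shows that the set under the supremum is nonempty. *)
    exists ((\sum_(j < n) rnorm (0 : (scalar_field R k)^o) `^ p) `^ p^-1).
    exists (fun _ => 0) => //; split=> [a v v' _ _|v _].
      by rewrite scaler0 addr0.
    by rewrite rnorm0 rnorm_ge0.
  move=> _ [alpha alphaF <-].
  have S0 : 0 <= \sum_j rnorm (alpha (h j)) `^ p.
    by apply: sumr_ge0 => j _; exact: powR_ge0.
  rewrite ge0_ler_powR ?nnegrE ?(ltW pV0)// ?addr_ge0 ?(ltW e0)//.
  apply: (dual_ball_sum_powR p1 Flin alphaF Fh) => x.
  apply: le_trans (wle x); apply: ler_sum => j _.
  have := @rnormZ_powR R k (scalar_field R k)^o (w j) p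
    (f (psi j * x)%g) p0 (w0 j).
  by move=> <-.
have Cp0 : 0 <= C `^ p by exact: powR_ge0.
(* After raising to the power [p], the error enters linearly and can be sent to [0]. *)
suff : rnorm (u f) `^ p <= C `^ p * J.
  move=> /(ge0_ler_powR (ltW pV0)); rewrite !nnegrE !(mulr_ge0, powR_ge0)//.
  move=> /(_ isT isT); rewrite powRM ?powR_ge0//.
  by rewrite !powRK ?rnorm_ge0.
apply/ler_addgt0Pr => e e0.
(* The added [1] keeps the denominator positive when [C = 0]; multiplying by [C^p] still gives at
   most [e]. *)
have e'0 : 0 < e / (C `^ p + 1) by rewrite divr_gt0// ltr_wpDl.
have := approx _ e'0; move=> /(ge0_ler_powR (ltW p0)).
rewrite !nnegrE rnorm_ge0 mulr_ge0 ?powR_ge0// => /(_ isT isT) /le_trans; apply.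
rewrite powRM ?powR_ge0// powRVK ?addr_ge0 ?(ltW e'0)//.
rewrite mulrDr lerD2l mulrCA ler_piMr ?(ltW e0)//.
by rewrite ler_pdivrMr ?mul1r ?lerDl// ltr_wpDl.
Qed.

Theorem theorem4p1p1 (R : realType) (k : scalar_kind)
    (G : compactHausdorffGroupType)
    (X : completeNormedModType (scalar_field R k))
    (F : set (cfun R k G)) (u : cfun R k G -> X) (p : R)
    (sigma : probability (borel G) R) :
  1 <= p ->
  linear_subspace F ->
  closed_translation_invariant F ->
  p_summing F p u ->
  translation_invariant_on F u ->
  normalized_haar sigma ->
  forall f : cfun R k G, F f ->
    rnorm (u f) <=
    summing_norm F p u * (\int[sigma]_x (rnorm (f x) `^ p)) `^ p^-1.
Proof.
move=> p1 Flin Ftr [ulin _ [C hC]] uinv haar f Ff.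
have le D (hD : summing_constant F p u D) :=
  summing_constant_haar p1 Flin Ftr ulin uinv haar hD Ff.
set J := _ `^ p^-1 in le *.
have : 0 <= J by exact: powR_ge0.
rewrite le_eqVlt => /predU1P[J0|J0].
  (* When [J = 0] division is impossible, but a single constant [C] already bounds the left-hand
     side by [0]. *)
  by rewrite -J0 mulr0 (le_trans (le _ hC))// -J0 mulr0.
(* For [J > 0] the quotient by [J] is a lower bound of the nonempty set of summing constants. *)
rewrite -ler_pdivrMr//; apply: lb_le_inf; first by exists C.
by move=> D hD; rewrite ler_pdivrMr// le.
Qed.
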